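(* Let $\pi$ be an indecomposable permutation of order $n$. Suppose the class $\mathrm{Av}(\pi)$ admits a splitting $$\{\mathrm{Av}(\pi_1),\mathrm{Av}(\pi_2),\dots,\mathrm{Av}(\pi_k)\}$$ for a (nonempty) multiset $\{\pi_1,\dots,\pi_k\}$ of indecomposable permutations. Then there is an integer $K\le 16^n$ such that $\mathrm{Av}(1\oplus\pi)$ admits the splitting $$\{\mathrm{Av}(1\oplus\pi_1),\mathrm{Av}(1\oplus\pi_2),\dots,\mathrm{Av}(1\oplus\pi_k)\}^{*K}.$$
   Context: A permutation of order $n\ge 1$ is a sequence of the $n$ distinct numbers of $[n]=\{1,\dots,n\}$ (permutations are nonempty). A permutation $\pi$ contains a permutation $\sigma$ if $\pi$ has a subsequence order-isomorphic to $\sigma$; otherwise $\pi$ avoids $\sigma$. $\mathrm{Av}(\sigma)$ is the set of all $\sigma$-avoiding permutations. A permutation class is a set of permutations closed under taking contained permutations. The direct sum of $\sigma\in S_m$ and $\pi\in S_n$ is $\sigma\oplus\pi=\sigma(1),\dots,\sigma(m),\pi(1)+m,\dots,\pi(n)+m\in S_{m+n}$. A permutation is decomposable if it is a direct sum of two (nonempty) permutations, and indecomposable otherwise. The symbol $1$ denotes the permutation of order one. For permutation classes $P_1,\dots,P_m$, let $P_1\odot\dots\odot P_m$ be the set of all permutations whose entries can be colored by $m$ colors so that for each $i$ the subsequence of color $i$ is either empty or order-isomorphic to an element of $P_i$. A multiset $\{P_1,\dots,P_m\}$ of permutation classes is a splitting of a class $C$ if $C\subseteq P_1\odot\dots\odot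 P_m$. For a multiset $\mathcal S$ and an integer $K$, $\mathcal S^{*K}$ denotes the multiset obtained from $\mathcal S$ by multiplying the multiplicity of each element by $K$. *)

(* Defs.v *)
From HB Require Import structures.
From mathcomp Require Import all_boot.

Set Implicit Arguments.
Unset Strict Implicit.
Unset Printing Implicit Defensive.

(* Permutations are kept in one-line notation, so that permutations of all     *)
(* orders live in one type and direct sums and subsequences are plain          *)
(* sequence operations.                                                        *)
Definition is_permutation (s : seq nat) : bool :=
  (0 < size s) && perm_eq s (iota 1 (size s)).

Record permutation := Permutation {
  one_line :> seq nat;
  one_lineP : is_permutation one_line
}.

HB.instance Definition _ := [isSub for one_line].
HB.instance Definition _ := [Equality of permutation by <:].

Definition perm_order (p : permutation) : nat := size p.

Definition order_iso (s t : seq nat) : Prop :=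
  size s = size t /\
  forall i j, i < size s -> j < size s ->
    (nth 0 s i < nth 0 s j) = (nth 0 t i < nth 0 t j).

Definition contains (p s : permutation) : Prop :=
  exists2 t : seq nat, subseq t p & order_iso t s.

Definition avoids (p s : permutation) : Prop := ~ contains p s.

Lemma contains_trans (q p s : permutation) :
  contains p q -> contains q s -> contains p s.
Proof.
move=> [t tp [szt ot]] [u /subseqP[m szm ->] [szu ou]].
have maskE (r : seq nat) : size r = size q ->
    mask m r = map (nth 0 r) (mask m (iota 0 (size q))).
  by move=> szr; rewrite map_mask -szr -/(mkseq _ _) mkseq_nth.
exists (mask m t); first exact: (subseq_trans (mask_subseq m t) tp).
set a := mask m (iota 0 (size q)) in maskE.
have lt_a i : i < size a -> nth 0 a i < size q.
  move=> lti; have /mem_mask : nth 0 a i \in a by apply: mem_nth.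
  by rewrite mem_iota.
rewrite (maskE q) // in szu ou; rewrite (maskE t) //.
rewrite /order_iso !size_map in szu ou *; split=> // i j lti ltj.
rewrite -ou // !(nth_map 0) // ot // szt; exact: lt_a.
Qed.

Record permClass := PermClass {
  in_class :> permutation -> Prop;
  in_class_closed : forall p s, in_class p -> contains p s -> in_class s
}.

Lemma avoids_closed (s p q : permutation) :
  avoids p s -> contains p q -> avoids q s.
Proof. by move=> avp pq qs; apply: avp; apply: contains_trans qs. Qed.

Definition Av (s : permutation) : permClass :=
  PermClass (fun p q => @avoids_closed s p q).

Lemma dsum_subproof (s p : permutation) :
  is_permutation (s ++ [seq x + size s | x <- p]).
Proof.
case: s p => s /andP[s0 ps] [p /andP[p0 pp]] /=.
rewrite /is_permutation size_cat size_map addn_gt0 s0 /=.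
rewrite iotaD; apply: perm_cat => //.
rewrite [1 + _]addnC iotaDl; under eq_map => x do rewrite addnC.
exact: perm_map.
Qed.

Definition dsum (s p : permutation) : permutation :=
  Permutation (dsum_subproof s p).

Definition decomposable (p : permutation) : Prop :=
  exists s t : permutation, p = dsum s t.

Definition indecomposable (p : permutation) : Prop := ~ decomposable p.

Definition perm_one : permutation := @Permutation [:: 1] isT.

(* Finite multisets of classes are represented by sequences; the order of the  *)
(* sequence plays no role. As the entries of p are distinct numbers, coloring  *)
(* entries amounts to coloring values, and [seq x <- p | c x == i] is the      *)
(* subsequence of color i.                                                     *)
Definition merge_of (S : seq permClass) (p : permutation) : Prop :=
  exists c : nat -> 'I_(size S), forall i : 'I_(size S),
    let pi := [seq x <- (p : seq nat) | c x == i] in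
    pi = [::] \/ exists2 s : permutation, tnth (in_tuple S) i s & order_iso pi s.

Definition splitting (S : seq permClass) (C : permClass) : Prop :=
  forall p : permutation, C p -> merge_of S p.

Definition mset_scale (S : seq permClass) (K : nat) : seq permClass :=
  flatten [seq nseq K P | P <- S].

(* Main.v *)
(* Let r avoid 1 + p. Every entry of r that is not a left-to-right minimum has  *)
(* a nonempty interval of left-to-right minima below and to its left. Two such  *)
(* entries form an inversion above a common minimum iff their intervals cross   *)
(* (overlap without nesting), so an indecomposable pattern above a common       *)
(* minimum is connected by crossings, and r contains 1 + p iff p occurs in a    *)
(* family of intervals with a common point. What remains is an argument in the  *)
(* style of Gyarfas' bound for the chromatic number of circle graphs, where     *)
(* families with a common point are handled by the given splitting of Av p.     *)
(* Layering a crossing-connected family by the distance from its leftmost       *)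
(* interval, with the parity of the layer and the side on which an interval is  *)
(* crossed by the previous layer as colors, shows that a family needing many    *)
(* colors has a subfamily needing about a quarter of them, each member of which *)
(* is crossed by an interval of the family that leaves the whole subfamily on   *)
(* the left, say. Each such step adds a new largest entry at an arbitrary       *)
(* position of the pattern built so far (dually, on the right, a new last entry *)
(* of arbitrary value), so about 2 * size p steps, of which size p go the same  *)
(* way, produce p; hence 4 ^ (2 * size p) colors suffice.                       *)
Require Import Defs.
From HB Require Import structures.
From mathcomp Require Import all_boot zify.

Set Implicit Arguments.
Unset Strict Implicit.
Unset Printing Implicit Defensive.

(** The theorem behaves like a coloring bound for circle graphs in which large cliques are replaced
    by copies of [p] over a common point. An entry of [r] that is no left-to-right minimum becomes
    an interval: right ends follow positions ([right_end_pos]), left ends follow values in reverse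
    ([left_end_value]), and [left_right_end] detects minima below one entry and before another. If
    [r] avoids [dsum perm_one p], no pairwise overlapping intervals form a copy of [p]
    ([occurrence_contains]), so every pairwise overlapping family is colored by the given splitting
    ([splittable_clique]).

    Call a family good if it can be colored with one color per pattern of [ps], avoiding overlapping
    copies. Good families can be glued along crossing components, since an indecomposable pattern is
    connected by inversions ([pattern_splittable_ideal]). It remains to cover all intervals by
    [16 ^ n] good families. Layering by crossing distance ([colorable_of_attached]) passes to
    subfamilies attached on the left or on the right; [rich] records chains of such steps. A chain
    of [n - 1] left steps realizes any pattern of order [n] ([rich_pattern]), and reflection treats
    right steps, so the recursion stops. Its cost is computed in [colorable_not_rich]. *)

Section Intervals.

(** * Families of intervals: crossings, attachment, richness *)

Variable T : finType.
Implicit Types (L R : T -> nat) (A B C D F : {set T}) (good : {set T} -> Prop).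

Definition endpoints L R : Prop :=
  [/\ injective L, injective R, forall x, L x < R x & forall x y, L x != R y].

Definition nested L R x y : bool := (L y < L x) && (R x < R y).

Definition crossing L R x y : bool :=
  [&& L x < L y, L y < R x & R x < R y] || [&& L y < L x, L x < R y & R y < R x].

(** All that the coloring argument needs of a color class: pairwise overlapping families are
    allowed, and a family may be tested one crossing component at a time, a [key] being a label
    constant on components. *)
Definition crossing_ideal L R good : Prop :=
  [/\ forall A B, A \subset B -> good B -> good A,
      forall A, {in A &, forall x y, L x < R y} -> good A
    & forall A (key : T -> nat),
        {in A &, forall x y, crossing L R x y -> key x = key y} ->
        (forall i, good [set x in A | key x == i]) -> good A].

Definition colorable good (t : nat) A : Prop :=
  exists2 c : T -> nat, {in A, forall x, c x < t} &
    forall i, good [set x in A | c x == i].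

(** The witness starts before the whole of [B], not only before [x], so it is extreme relative to
    any pattern found inside [B]. *)
Definition left_attached L R F B : Prop :=
  forall x, x \in B -> exists y, [/\ y \in F, {in B, forall z, L y < L z},
                                     L x < R y & R y < R x].

Definition right_attached L R F B : Prop :=
  forall x, x \in B -> exists y, [/\ y \in F, {in B, forall z, R z < R y},
                                     L x < L y & L y < R x].

(** In [rich_pattern] the middle interval catches a new right end and the outer two refill the
    halves of the gap that it splits. *)
Definition spacious L R B : {set T} :=
  [set x in B | [exists s1 in B, exists s2 in B, exists s3 in B,
     [&& L x <= L s1, R s1 < L s2, R s2 < L s3 & R s3 <= R x]]].

(** The base triple is a first entry [x] with a spare interval for each of its two gaps. *)
Fixpoint rich L R (k : nat) F : Prop :=
  if k is k'.+1 then
    exists B, [/\ B \subset F, left_attached L R F B & rich L R k' (spacious L R B)]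
  else exists x y z, [/\ x \in F, y \in F, z \in F, nested L R y x & R x < L z].

Definition reflect_l (M : nat) R : T -> nat := fun x => M - R x.

(** * Coloring intervals by good families *)

Section Coloring.

Variables (L R : T -> nat) (good : {set T} -> Prop).
Hypotheses (epLR : endpoints L R) (goodP : crossing_ideal L R good).

Let L_inj : injective L. Proof. by case: epLR. Qed.
Let R_inj : injective R. Proof. by case: epLR. Qed.
Let ltLR x : L x < R x. Proof. by case: epLR. Qed.
Let neLR x y : L x != R y. Proof. by case: epLR. Qed.

Let good_sub A B : A \subset B -> good B -> good A.
Proof. by case: goodP => + _ _; apply. Qed.
Let good_clique A : {in A &, forall x y, L x < R y} -> good A.
Proof. by case: goodP => _ + _; apply. Qed.
Let good_key A (key : T -> nat) :
  {in A &, forall x y, crossing L R x y -> key x = key y} ->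
  (forall i, good [set x in A | key x == i]) -> good A.
Proof. by case: goodP => _ _; apply. Qed.

Lemma colorable_sub t t' A B :
  A \subset B -> t <= t' -> colorable good t B -> colorable good t' A.
Proof.
move=> /subsetP AB tt' [c ct cgood]; exists c => [x /AB /ct|i].
  by move=> /leq_trans; apply.
by apply: good_sub (cgood i); apply/subsetP => x; rewrite !inE => /andP[/AB -> ->].
Qed.

Lemma colorable_setU a b A B :
  colorable good a A -> colorable good b B -> colorable good (a + b) (A :|: B).
Proof.
move=> [c ca cg] [d db dg].
exists (fun x => if x \in A then c x else a + d x) => [x|i].
  rewrite inE; case: ifP => [/ca|_ /= /db]; lia.
have [ia|ia] := ltnP i a.
  apply: good_sub (cg i); apply/subsetP => x; rewrite !inE.
  case: ifP => //= _ /andP[_ /eqP]; lia.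
apply: good_sub (dg (i - a)); apply/subsetP => x; rewrite !inE.
case: ifP => [/ca|_ /=]; first by move=> + /eqP; lia.
by move=> /andP[-> /eqP]; lia.
Qed.

Lemma colorable_cover a b C A B :
  C \subset A :|: B -> colorable good a A -> colorable good b B ->
  colorable good (a + b) C.
Proof. by move=> /colorable_sub CAB /colorable_setU cA /cA; apply: CAB. Qed.

Lemma colorable_key t A (I : eqType) (key : T -> I) :
  {in A &, forall x y, crossing L R x y -> key x = key y} ->
  (forall x, x \in A -> colorable good t [set y in A | key y == key x]) ->
  colorable good t A.
Proof.
move=> keyP cK.
have /fin_all_exists[c cP] (x : T) : exists c : T -> nat, x \in A ->
    {in [set y in A | key y == key x], forall y, c y < t} /\
    forall i, good [set z in [set y in A | key y == key x] | c z == i].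
  have [/cK[c c1 c2]|_] := boolP (x \in A); first by exists c.
  by exists (fun=> 0).
pose rep x := odflt x [pick y in A | key y == key x].
have repP x : x \in A -> rep x \in A /\ key (rep x) = key x.
  rewrite /rep => xA; case: pickP => [y /andP[yA /eqP ky]|/(_ x)] /=; first by [].
  by rewrite xA eqxx.
have rep_eq x y : x \in A -> key x = key y -> rep x = rep y.
  rewrite /rep => xA <-; case: pickP => //= /(_ x); by rewrite xA eqxx.
exists (fun x => c (rep x) x) => [x xA|i].
  have [rA kr] := repP x xA; have [+ _] := cP _ rA; apply.
  by rewrite inE xA kr eqxx.
(* [crossing_ideal] takes keys in [nat], so a class is encoded by the rank of its representative. *)
have [e ekey]: exists e : T -> nat, {in A &, forall x y, e x = e y <-> key x = key y}.
  exists (fun x => val (enum_rank (rep x))) => x y xA yA; split=> [|/(rep_eq _ _ xA) -> //].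
    move=> /val_inj/enum_rank_inj exy.
    by have [_ <-] := repP x xA; rewrite exy; have [_ ->] := repP y yA.
apply: (@good_key _ e) => [x y|j].
  rewrite !inE => /andP[xA _] /andP[yA _] xy.
  by apply/(ekey _ _ xA yA); apply: keyP.
have [x /andP[xA /eqP ex]|no] := pickP [pred x in A | e x == j]; last first.
  apply: good_clique => x y; rewrite !inE => /andP[/andP[xA _] xj].
  by have := no x; rewrite inE xA xj.
have [rA kr] := repP x xA; have [_ /(_ i)] := cP _ rA.
apply: good_sub; apply/subsetP => y; rewrite !inE => /andP[/andP[yA cy] ey].
have /ekey k : e y = e x by rewrite ex; apply/eqP.
by rewrite yA kr k //= eqxx /= (rep_eq x y) ?k.
Qed.

Lemma colorable_clique A : {in A &, forall x y, L x < R y} -> colorable good 1 A.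
Proof.
move=> Acl; exists (fun=> 0) => // i; apply: good_clique => x y.
by rewrite !inE => /andP[xA _] /andP[yA _]; apply: Acl.
Qed.

Lemma colorable_classes t A (c key : T -> nat) :
  {in A, forall x, c x < t} ->
  {in A &, forall x y, key x = key y -> L x < R y} ->
  {in A &, forall x y, c x = c y -> crossing L R x y -> key x = key y} ->
  colorable good t A.
Proof.
move=> ct kcl ck; exists c => // i.
apply: (@good_key _ key) => [x y|j].
  rewrite !inE => /andP[xA /eqP cx] /andP[yA /eqP cy].
  by apply: ck => //; rewrite cx cy.
apply: good_clique => x y; rewrite !inE.
move=> /andP[/andP[xA _] /eqP kx] /andP[/andP[yA _] /eqP ky].
by apply: kcl => //; rewrite kx ky.
Qed.

(** * Discarding intervals that are not spacious, and passing to nested ones *)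

Fixpoint packing F (m p : nat) : bool :=
  if m is m'.+1 then [exists s in F, (R s <= p) && packing F m' (L s)] else true.

Lemma packing_le F m p q : p <= q -> packing F m p -> packing F m q.
Proof.
case: m => //= m pq /exists_inP[s sF /andP[sp pk]].
by apply/exists_inP; exists s => //; rewrite pk (leq_trans sp).
Qed.

Lemma packing_leq F m p : packing F m p -> m <= p.
Proof.
elim: m p => //= m IH p /exists_inP[s sF /andP[sp /IH]].
by have := ltLR s; lia.
Qed.

Lemma packing_pred F m p : packing F m.+1 p -> packing F m p.
Proof.
move=> /exists_inP[s _ /andP[sp]]; apply: packing_le.
by have := ltLR s; lia.
Qed.

Definition packing_number F p : nat :=
  ex_maxn (ex_intro (packing F ^~ p) 0 isT) (fun m => @packing_leq F m p).

Lemma packing_numberE F m p : (m <= packing_number F p) = packing F m p.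
Proof.
rewrite /packing_number; case: ex_maxnP => n pn maxn.
apply/idP/idP => [|/maxn //]; move: pn.
elim: n {maxn} => [|n IH] pn; first by rewrite leqn0 => /eqP ->.
by rewrite leq_eqVlt => /predU1P[-> //|]; apply/IH/packing_pred.
Qed.

(* Color by the packing number at the left endpoint modulo 4: it grows by at   *)
(* least 1 and, for the intervals in question, by at most 3 along an interval. *)
Lemma colorable_not_spacious B : colorable good 4 (B :\: spacious L R B).
Proof.
pose a x := packing_number B (L x); pose b x := packing_number B (R x).
have homo p q : p <= q -> packing_number B p <= packing_number B q.
  by move=> pq; rewrite packing_numberE; apply: packing_le pq _; rewrite -packing_numberE.
have ab x : x \in B -> a x < b x.
  move=> xB; rewrite packing_numberE; apply/exists_inP; exists x => //.
  rewrite leqnn -/(packing B (a x) (L x)) -packing_numberE; exact: leqnn.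
have ba x : x \in B :\: spacious L R B -> b x <= a x + 3.
  rewrite !inE => /andP[+ xB]; rewrite xB /= leqNgt; apply: contraNN.
  rewrite -addnS packing_numberE addnC => /exists_inP[s3 s3B /andP[le3]].
  move=> /exists_inP[s2 s2B /andP[le2]] /exists_inP[s1 s1B /andP[le1 pk]].
  apply/exists_inP; exists s1 => //; apply/exists_inP; exists s2 => //.
  apply/exists_inP; exists s3 => //; rewrite le3 andbT.
  have := neLR s2 s1; have := neLR s3 s2.
  case: (leqP (L x) (L s1)) => [|lt]; first by lia.
  have : packing B (a x).+1 (L x) by exact: (@packing_le B (a x).+1 _ _ (ltnW lt) pk).
  by rewrite -packing_numberE ltnn.
apply: (@colorable_classes _ _ (fun x => a x %% 4) a).
- by move=> x _; rewrite ltn_mod.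
- move=> x y /setDP[xB _] /setDP[yB _] axy.
  rewrite ltnNge; apply/negP => /homo; have := ab y yB; rewrite -/(a x) -/(b y); lia.
- suff H x y : x \in B :\: spacious L R B -> y \in B :\: spacious L R B ->
      a x %% 4 = a y %% 4 -> crossing L R x y -> a x <= a y.
    move=> x y xD yD c xy; apply/eqP; rewrite eqn_leq !H //.
    by move: xy; rewrite /crossing; lia.
  move=> xD yD c xy; rewrite leqNgt; apply/negP => lt.
  have : b y < a x by have := ba y yD; lia.
  rewrite ltnNge; apply/negP/negPn/homo; move: xy; rewrite /crossing; lia.
Qed.

Lemma colorable_of_spacious t B :
  colorable good t (spacious L R B) -> colorable good (t + 4) B.
Proof.
move=> cS; apply: colorable_cover cS (colorable_not_spacious B).
by apply/subsetP => x xB; rewrite in_setU in_setD xB andbT orbN.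
Qed.

Lemma spacious_sub B : spacious L R B \subset B.
Proof. by apply/subsetP => x; rewrite inE => /andP[]. Qed.

Lemma spaciousP B x : x \in spacious L R B ->
  exists s1 s2 s3, [/\ [/\ s1 \in B, s2 \in B & s3 \in B],
     L x <= L s1, R s1 < L s2, R s2 < L s3 & R s3 <= R x].
Proof.
rewrite inE => /andP[_ /exists_inP[s1 s1B /exists_inP[s2 s2B /exists_inP[s3 s3B]]]].
by move=> /and4P[? ? ? ?]; exists s1, s2, s3.
Qed.

Lemma colorable_not_rich0 F : ~ rich L R 0 F -> colorable good 5 F.
Proof.
move=> nrich; have [->|[x0 x0F]] := set_0Vmem F.
  by apply: (@colorable_sub 1 5 _ set0) => //; apply: colorable_clique => x; rewrite inE.
case: (@arg_maxnP _ x0 (mem F) L x0F) => z zF zmax.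
pose A := [set x in F | R x < L z].
apply: (@colorable_cover 4 1 _ A [set x in F | L z < R x]).
- apply/subsetP => x xF; rewrite !inE xF /=.
  by have := neLR z x; lia.
- apply: colorable_sub (colorable_not_spacious A) => //.
  apply/subsetP => x xA; rewrite inE xA andbT; apply/negP.
  move=> /spaciousP[s1 [s2 [s3 [[s1A s2A s3A] *]]]].
  apply: nrich; exists x, s2, z; move: xA s2A; rewrite !inE => /andP[xF xz] /andP[s2F _].
  split=> //; rewrite /nested; have := ltLR s1; have := ltLR s3; lia.
- apply: colorable_clique => x y; rewrite !inE => /andP[xF _] /andP[yF lt].
  by have := zmax x xF; lia.
Qed.

(* The farthest point reached from [p] by one interval of [D], or [p + 1]. *)
Definition jump D p : nat := maxn p.+1 (\max_(x in D | L x <= p) R x).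

Lemma colorable_of_nested t D :
  (forall k, k \in D -> colorable good t [set x in D | nested L R x k]) ->
  colorable good (t + 2) D.
Proof.
move=> cN; pose e i := iter i (jump D) 0.
have e_lt i : e i < e i.+1 by rewrite /e /= /jump leq_max ltnSn.
have ge_e i : i <= e i by elim: i => // i IH; apply: leq_ltn_trans (e_lt i).
have e_mono i j : i <= j -> e i <= e j.
  by move=> /subnK <-; elim: (j - i) => // m IH; apply/(leq_trans IH)/ltnW/e_lt.
have ex_i x : exists i, L x <= e i by exists (L x).
pose idx x := ex_minn (ex_i x).
have idxP x : L x <= e (idx x) by rewrite /idx; case: ex_minnP.
have idx_min x i : i < idx x -> e i < L x.
  rewrite /idx; case: ex_minnP => m _ min im; rewrite ltnNge; apply/negP => /min; lia.
have R_jump x i : x \in D -> L x <= e i -> R x <= e i.+1.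
  move=> xD Lx; rewrite /e /= /jump leq_max; apply/orP; right.
  by rewrite (bigD1 x) ?xD //= leq_maxl.
pose A := [set x in D | R x <= e (idx x)].
apply: (@colorable_cover t 2 _ A (D :\: A)).
- by apply/subsetP => x xD; rewrite in_setU in_setD xD andbT orbN.
- apply: (@colorable_key _ _ _ idx) => [|x]; last rewrite inE => /andP[xD xR].
    suff H x y : x \in A -> y \in A -> crossing L R x y -> idx x <= idx y.
      move=> x y xD yD xy; apply/eqP; rewrite eqn_leq !H //.
      by move: xy; rewrite /crossing; lia.
    rewrite !inE => /andP[xD xR] /andP[yD yR] xy.
    rewrite leqNgt; apply/negP => /idx_min; move: xy; rewrite /crossing; lia.
  (* Index 0 would force [R x <= 0], and a jump made by no interval has length one, too short to
     hold [x]. *)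
  have := ltLR x; have := idxP x; case def_i: (idx x) => [|i] Lx ltx.
    by move: xR Lx; rewrite def_i /e /=; lia.
  have lti : e i < L x by apply: idx_min; rewrite def_i.
  have [k kD [kL kR]] : exists2 k, k \in D & L k <= e i /\ e i.+1 = R k.
    case: (pickP [pred k in D | L k <= e i]) => [k0 /andP[k0D k0L]|none]; last first.
      have : e i.+1 = (e i).+1.
        rewrite /e /= /jump big_pred0 ?maxn0 // => k; exact: none.
      by move: xR; rewrite def_i; lia.
    have [|k /andP[kD kL] def_k] := @eq_bigmax_cond T (fun k => (k \in D) && (L k <= e i)) R.
      by apply/card_gt0P; exists k0; apply/andP.
    exists k => //; split=> //; rewrite /e /= /jump def_k -/(e i).
    by apply/maxn_idPr; move: xR; rewrite def_i /e /= /jump def_k -/(e i); lia.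
  apply: colorable_sub (cN k kD) => //; apply/subsetP => y; rewrite !inE.
  move=> /andP[/andP[yD yR] /eqP iy]; rewrite yD /nested.
  have := @idx_min y i; rewrite iy => /(_ (ltnSn _)) yL.
  move: yR; rewrite iy kR leq_eqVlt => /predU1P[/R_inj yk|->].
    by move: yL; rewrite yk; lia.
  by rewrite andbT; lia.
- apply: (@colorable_classes _ _ (fun x => idx x %% 2) idx).
  + by move=> x _; rewrite ltn_mod.
  + move=> x y /setDP[xD _] /setDP[yD]; rewrite inE yD /= -ltnNge => yR ixy.
    by apply: leq_ltn_trans yR; rewrite -ixy.
  + suff H x y : x \in D -> y \in D -> idx x %% 2 = idx y %% 2 ->
        crossing L R x y -> idx x <= idx y.
      move=> x y /setDP[xD _] /setDP[yD _] c xy; apply/eqP; rewrite eqn_leq !H //.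
      by move: xy; rewrite /crossing; lia.
    move=> xD yD c xy; rewrite leqNgt; apply/negP => lt.
    have /idx_min lt1 : (idx y).+1 < idx x by lia.
    have := R_jump y _ yD (idxP y); move: xy; rewrite /crossing; lia.
Qed.

(** * Layers of a crossing-connected family *)

Section Layers.

Variables (C : {set T}) (root : T) (t1 t2 : nat).
Hypotheses (rootC : root \in C) (root_min : {in C, forall x, L root <= L x}).

Fixpoint reach (m : nat) : pred T :=
  if m is m'.+1 then
    [pred x in C | [exists y, reach m' y && crossing L R y x]]
  else pred1 root.

Hypothesis reachC : {in C, forall x, exists m, reach m x}.
Hypotheses (cleft : forall B, B \subset C -> left_attached L R C B -> colorable good t1 B)
           (cright : forall B, B \subset C -> right_attached L R C B -> colorable good t2 B).

Lemma reach_in m x : reach m x -> x \in C.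
Proof. by case: m => [/eqP ->|m /andP[]]. Qed.

(* A crossing path from the root into the inside of [k] must cross [k]. *)
Lemma reach_nested m x k :
  reach m x -> k \in C -> nested L R x k -> exists2 m', m' <= m & reach m' k.
Proof.
elim: m x => [|m IH] x /=; first by move=> /eqP -> /root_min; rewrite /nested; lia.
move=> /andP[xC /existsP[y /andP[yr yx]]] kC xk.
have [yk|nyk] := boolP (nested L R y k).
  by have [m' m'm mk] := IH y yr kC yk; exists m' => //; lia.
exists m.+1 => //; apply/andP; split=> //; apply/existsP; exists y; apply/andP; split=> //.
move: yx xk nyk; rewrite /crossing /nested.
have := neLR y k; have := neLR k y.
have := @L_inj y k; have := @R_inj y k.
have [->|nyk] := eqVneq y k; first by lia.
move=> injR injL.
have /eqP : R y != R k by apply/eqP => /injR /eqP; apply/negP.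
have /eqP : L y != L k by apply/eqP => /injL /eqP; apply/negP.
lia.
Qed.

Let exC x : exists m, (x \in C) ==> reach m x.
Proof.
by have [/reachC[m rm]|] := boolP (x \in C); [exists m | exists 0].
Qed.
Let dist x := ex_minn (exC x).

Let dist_reach x : x \in C -> reach (dist x) x.
Proof. by move=> xC; rewrite /dist; case: ex_minnP => m; rewrite xC. Qed.

Let dist_le m x : reach m x -> dist x <= m.
Proof.
move=> xm; rewrite /dist; case: ex_minnP => m' _; apply.
by rewrite xm implybT.
Qed.

Let dist_crossing x y : x \in C -> y \in C -> crossing L R x y -> dist y <= (dist x).+1.
Proof.
move=> xC yC xy; apply: dist_le; apply/andP; split=> //; apply/existsP; exists x.
by apply/andP; split=> //; apply: dist_reach.
Qed.

(** Each member of a layer is crossed from the previous layer on the left or on the right. For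
    members nested in some [k] of the same layer, these predecessors are not nested in [k], or [k]
    would be nearer to the root. So they stick out of [k], which makes the nested members attached;
    [colorable_of_nested] adds 2 colors per side. *)
Lemma colorable_layer d :
  colorable good (t1 + t2 + 4) [set x in C | dist x == d].
Proof.
set D := [set x in C | _].
case: d @D => [|d] D.
  apply: (@colorable_sub 1 _ _ [set root]) => //; last 1 first.
  - by apply: colorable_clique => x y /set1P -> /set1P ->.
  - apply/subsetP => x; rewrite /D inE => /andP[xC /eqP dx].
    by have := dist_reach xC; rewrite dx => /eqP ->; rewrite inE.
  - lia.
have outside x k y : x \in D -> k \in D -> nested L R x k ->
    y \in C -> dist y = d -> ~~ nested L R y k.
  rewrite !inE => /andP[xC _] /andP[kC /eqP dk] xk yC dy; apply/negP => yk.
  have [m md /dist_le] := reach_nested (dist_reach yC) kC yk.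
  by rewrite dk; lia.
pose lpred x y := [&& y \in C, dist y == d, L y < L x, L x < R y & R y < R x].
pose rpred x y := [&& y \in C, dist y == d, L x < L y, L y < R x & R x < R y].
have -> : t1 + t2 + 4 = (t1 + 2) + (t2 + 2) by lia.
apply: (@colorable_cover _ _ _ [set x in D | [exists y, lpred x y]]
                               [set x in D | [exists y, rpred x y]]).
- apply/subsetP => x; rewrite /D !inE => /andP[xC /eqP dx]; rewrite xC dx eqxx /=.
  have := dist_reach xC; rewrite dx => /andP[_ /existsP[y /andP[ym yx]]].
  have yC := reach_in ym.
  have dy : dist y = d.
    by apply/eqP; have := dist_le ym; have := dist_crossing yC xC yx; rewrite dx; lia.
  move: yx => /orP[yx|yx]; apply/orP; [left|right]; apply/existsP; exists y;
    by rewrite /lpred /rpred yC dy eqxx.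
- apply: colorable_of_nested => k; rewrite inE => /andP[kD _].
  apply: cleft => [|x].
    by apply/subsetP => x; rewrite !inE => /andP[/andP[/andP[->]]].
  rewrite inE => /andP[]; rewrite inE => /andP[xD /existsP[y]].
  move=> /and5P[yC /eqP dy yx1 yx2 yx3] xk; exists y; split=> // z.
  rewrite inE => /andP[_ zk]; have := outside x k y xD kD xk yC dy.
  by move: xk zk; rewrite /nested; lia.
- apply: colorable_of_nested => k; rewrite inE => /andP[kD _].
  apply: cright => [|x].
    by apply/subsetP => x; rewrite !inE => /andP[/andP[/andP[->]]].
  rewrite inE => /andP[]; rewrite inE => /andP[xD /existsP[y]].
  move=> /and5P[yC /eqP dy yx1 yx2 yx3] xk; exists y; split=> // z.
  rewrite inE => /andP[_ zk]; have := outside x k y xD kD xk yC dy.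
  by move: xk zk; rewrite /nested; lia.
Qed.

(** Crossing intervals lie in equal or consecutive layers, so layers of the same parity share
    colors. *)
Lemma colorable_layers : colorable good (2 * (t1 + t2 + 4)) C.
Proof.
have parity (b : bool) : colorable good (t1 + t2 + 4) [set x in C | odd (dist x) == b].
  apply: (@colorable_key _ _ _ dist) => [x y|x xC].
    rewrite !inE => /andP[xC /eqP ox] /andP[yC /eqP oy] xy.
    have yx : crossing L R y x by move: xy; rewrite /crossing; lia.
    have := dist_crossing xC yC xy; have := dist_crossing yC xC yx.
    by move: ox oy; case: b; lia.
  apply: colorable_sub (colorable_layer (dist x)) => //.
  by apply/subsetP => y; rewrite !inE => /andP[/andP[-> _] ->].
rewrite mul2n -addnn; apply: colorable_cover (parity true) (parity false).
by apply/subsetP => x xC; rewrite !inE xC; case: odd.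
Qed.

End Layers.

Lemma colorable_of_attached F t1 t2 :
  (forall B, B \subset F -> left_attached L R F B -> colorable good t1 B) ->
  (forall B, B \subset F -> right_attached L R F B -> colorable good t2 B) ->
  colorable good (2 * (t1 + t2 + 4)) F.
Proof.
move=> cl cr; pose e := [rel x y | [&& x \in F, y \in F & crossing L R x y]].
have e_sym : connect_sym e.
  apply: sym_connect_sym => x y /=; rewrite andbCA; congr [&& _, _ & _].
  by rewrite /crossing orbC.
apply: (@colorable_key _ _ _ (root e)) => [x y xF yF xy|x xF].
  by apply/rootP => //; apply: connect1; rewrite /= xF yF.
set C := [set y in F | _].
have CF : C \subset F by apply/subsetP => y; rewrite inE => /andP[].
have xC : x \in C by rewrite inE xF eqxx.
case: (@arg_minnP _ x (mem C) L xC) => r rC rmin.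
apply: (@colorable_layers C r) => // [y yC|B BC lB|B BC rB].
- have : connect e r y.
    by apply/(rootP e_sym); move: rC yC; rewrite !inE => /andP[_ /eqP ->] /andP[_ /eqP ->].
  move=> /connectP[q qP ->] {y yC}.
  elim/last_ind: q qP => [|q y IH]; first by exists 0 => /=.
  rewrite rcons_path last_rcons => /andP[qP /and3P[qF yF qy]].
  have [m rm] := IH qP; exists m.+1; apply/andP; split; last first.
    by apply/existsP; exists (last r q); apply/andP; split.
  have := reach_in rC rm; rewrite inE => /andP[_ /eqP lx].
  rewrite inE yF -lx; apply/eqP/rootP => //.
  by rewrite e_sym; apply: connect1; rewrite /= qF yF.
- apply: cl; first exact: subset_trans CF.
  move=> y /lB[z [zC ? ? ?]]; exists z; split=> //; exact: (subsetP CF).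
- apply: cr; first exact: subset_trans CF.
  move=> y /rB[z [zC ? ? ?]]; exists z; split=> //; exact: (subsetP CF).
Qed.

End Coloring.

Lemma rich_sub L R k A B : A \subset B -> rich L R k A -> rich L R k B.
Proof.
move=> AB; case: k => [|k] /=.
  by move=> [x [y [z [xA yA zA xy xz]]]]; exists x, y, z; split=> //; apply: (subsetP AB).
move=> [D [DA attD richD]]; exists D; split=> //; first exact: subset_trans AB.
by move=> x /attD[y [yA ? ? ?]]; exists y; split=> //; apply: (subsetP AB).
Qed.

(** * Exchanging left and right; the recursion for the number of colors *)

Section Reflection.

Variables (L R : T -> nat) (M : nat).
Hypotheses (epLR : endpoints L R) (R_le : forall x, R x <= M).

Let L' := reflect_l M R.
Let R' := reflect_l M L.

Let ltLR x : L x < R x. Proof. by case: epLR. Qed.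
Let neLR x y : L x != R y. Proof. by case: epLR. Qed.

Lemma endpoints_reflect : endpoints L' R'.
Proof.
rewrite /L' /R' /reflect_l; split=> [x y|x y|x|x y].
- by case: epLR => _ injR _ _; have := R_le x; have := R_le y => ? ? ?; apply: injR; lia.
- case: epLR => injL _ _ _; have := R_le x; have := R_le y.
  by have := ltLR x; have := ltLR y => ? ? ? ? ?; apply: injL; lia.
- by have := R_le x; have := ltLR x; lia.
- have := R_le x; have := R_le y; have := ltLR x; have := ltLR y; have := neLR y x; lia.
Qed.

Lemma crossing_ideal_reflect (good : {set T} -> Prop) :
  crossing_ideal L R good -> crossing_ideal L' R' good.
Proof.
rewrite /L' /R' /reflect_l => -[g1 g2 g3]; split=> // [A Acl|A key keyP].
  apply: g2 => x y xA yA; have := Acl y x yA xA.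
  by have := R_le x; have := R_le y; have := ltLR x; have := ltLR y; lia.
apply: g3 => x y xA yA xy; apply: keyP => //; move: xy; rewrite /crossing.
by have := R_le x; have := R_le y; have := ltLR x; have := ltLR y; lia.
Qed.

Lemma right_attached_reflect F B : right_attached L R F B -> left_attached L' R' F B.
Proof.
rewrite /L' /R' /reflect_l => rB x /rB[y [yF yz xy1 xy2]]; exists y.
have := R_le x; have := R_le y; have := ltLR x; have := ltLR y => ? ? ? ?.
split=> //; [|lia|lia] => z zB.
by have := yz z zB; have := R_le z; lia.
Qed.

Lemma spacious_reflect B : spacious L' R' B = spacious L R B.
Proof.
apply/setP => x; rewrite !inE; congr (_ && _).
apply/idP/idP => /exists_inP[s1 s1B /exists_inP[s2 s2B /exists_inP[s3 s3B H]]];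
  apply/exists_inP; exists s3 => //; apply/exists_inP; exists s2 => //;
  apply/exists_inP; exists s1 => //; move: H; rewrite /L' /R' /reflect_l;
  have := R_le x; have := R_le s1; have := R_le s2; have := R_le s3;
  have := ltLR x; have := ltLR s1; have := ltLR s2; have := ltLR s3; lia.
Qed.

(** An attached subfamily has a spacious part that lacks one step of richness on its side, and
    inherits the other bound. Discarding what is not spacious costs 4 colors, so [b] becomes
    [2 * ((b + 4) + (b + 4) + 4) = 4 * b + 24], which [16 * 4 ^ (p + q) - 8] satisfies exactly. *)
Lemma colorable_not_rich (good : {set T} -> Prop) p q F :
  crossing_ideal L R good -> ~ rich L R p F -> ~ rich L' R' q F ->
  colorable good (16 * 4 ^ (p + q) - 8) F.
Proof.
move=> goodP; have goodP' := crossing_ideal_reflect goodP.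
elim: p q F => [|p IHp] q F.
  move=> nr _; apply: (colorable_sub goodP) (colorable_not_rich0 epLR goodP nr) => //.
  by have := expn_gt0 4 (0 + q); lia.
elim: q F => [|q IHq] F nl nr.
  apply: (colorable_sub goodP) (colorable_not_rich0 endpoints_reflect goodP' nr) => //.
  by have := expn_gt0 4 (p.+1 + 0); lia.
set b := 16 * 4 ^ (p + q.+1) - 8.
have -> : 16 * 4 ^ (p.+1 + q.+1) - 8 = 2 * ((b + 4) + (b + 4) + 4).
  by rewrite /b addSn expnS; have := expn_gt0 4 (p + q.+1); lia.
apply: (colorable_of_attached epLR goodP) => B BF attB; apply: (colorable_of_spacious epLR goodP).
  apply: IHp => [rB|rB]; first by apply: nl; exists B.
  by apply: nr; apply: rich_sub rB; apply: subset_trans BF; apply: spacious_sub.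
rewrite /b addnS -addSn; apply: IHq => [rB|rB].
  by apply: nl; apply: rich_sub rB; apply: subset_trans BF; apply: spacious_sub.
apply: nr; exists B; split=> //; first exact: right_attached_reflect.
by rewrite spacious_reflect.
Qed.

End Reflection.

(* The intervals [z g], one in each gap between the right endpoints of the     *)
(* [x d], make the induction work: an interval crossing [z g] on the left has  *)
(* its right endpoint in that gap.                                             *)
Lemma rich_pattern L R k F (u : nat -> nat) :
  (forall x, L x < R x) ->
  rich L R k F ->
  {in [pred d | d <= k] &, injective u} ->
  exists x z : nat -> T,
    [/\ forall d, d <= k -> x d \in F,
        forall d d', d < d' <= k -> L (x d) < L (x d'),
        forall d d', d <= k -> d' <= k -> u d < u d' -> R (x d) < R (x d'),
        forall d d', d <= k -> d' <= k -> L (x d) < R (x d')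
      & forall g, z g \in F /\ forall d, d <= k ->
          L (x d) < L (z g) /\ if u d < g then R (x d) < L (z g) else R (z g) < R (x d)].
Proof.
move=> ltLR; elim: k F u => [|k IH] F u /= rF u_inj.
  have [x [s [s' [xF sF s'F xs xs']]]] := rF.
  exists (fun=> x), (fun g => if u 0 < g then s' else s).
  split=> // [d d'|d d'|g]; [lia|rewrite !leqn0 => /eqP -> /eqP ->; lia|].
  split=> [|d]; first by case: ifP.
  rewrite leqn0 => /eqP ->; have := ltLR x; move: xs; rewrite /nested.
  by case: ifP; lia.
have [B [BF attB rB]] := rF.
have [|x [z [xB x_incr u_incr x_cl zP]]] := IH _ (fun d => u d.+1) rB.
  by move=> d d' dk d'k e; apply: succn_inj; apply: u_inj.
(* [z (u 0)] lies in the gap prescribed for the new right end. The interval [y] attached to its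
   middle part [s2] ends inside [s2] and starts before everything else. *)
have [zB _] := zP (u 0).
have [s1 [s2 [s3 [[s1B s2B s3B] h1 h2 h3 h4]]]] := spaciousP zB.
have [y [yF yL ys2 ys2']] := attB s2 s2B.
have sB := subsetP (spacious_sub L R B).
have y_left d : d <= k -> L y < L (x d) by move=> /xB/sB/yL.
have u_ne d : d <= k -> u d.+1 <> u 0 by move=> dk e; have := @u_inj d.+1 0 dk isT e.
(* If an old right end separates the gaps [g] and [u 0], then [z g] survives; otherwise [s1] or [s3]
   replaces it, on the proper side of [R y]. *)
pose between g := [exists d : 'I_k.+1, (g <= u d.+1 < u 0) || (u 0 < u d.+1 < g)].
exists (fun d => if d is d'.+1 then x d' else y).
exists (fun g => if between g then z g else if g <= u 0 then s1 else s3).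
have lts1 := ltLR s1; have lts2 := ltLR s2; have lts3 := ltLR s3.
have z0 d : d <= k -> _ := (zP (u 0)).2 d.
split.
- by case=> [|d] // dk; apply/(subsetP BF)/sB/xB.
- case=> [|d] [|d'] //; [by move=> dk; apply: y_left | exact: x_incr].
- case=> [|d] [|d'] //; [lia| | |].
  + move=> _ dk; have := z0 _ dk; case: ifP; lia.
  + move=> dk _; have := z0 _ dk; case: ifP; lia.
  + exact: u_incr.
- case=> [|d] [|d'] //.
  + by move=> _ dk; have := y_left _ dk; have := ltLR (x d'); lia.
  + move=> dk _; have := z0 _ dk; case: ifP; lia.
  + exact: x_cl.
move=> g; split.
  case: ifP => _; first by apply/(subsetP BF)/sB; case: (zP g).
  by apply: (subsetP BF); case: ifP.
have [zgB zg] := zP g.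
case: ifP => [/existsP[[d ltd] /= bd]|/negbT]; last first.
  rewrite negb_exists => /forallP nb.
  case=> [_|d dk].
    have := yL _ s1B; have := yL _ s3B; case: ifP; case: ifP; lia.
  have := nb (Ordinal (dk : d < k.+1)); rewrite /= negb_or.
  have := z0 d dk; have := u_ne d dk; case: ifP; case: ifP; case: ifP; lia.
case=> [_|d' dk]; last exact: zg.
have yz := yL _ (sB _ zgB); split=> //.
have := zg d ltd; have := z0 d ltd; have := ltLR (z g); have := ltLR (z (u 0)).
have := u_ne d ltd.
case: ifP; case: ifP; case: ifP; lia.
Qed.
End Intervals.

(** * Indecomposable permutations and inversions *)

Lemma permutation_uniq (p : permutation) : uniq p.
Proof. by case/andP: (one_lineP p) => _ /seq.perm_uniq ->; apply: iota_uniq. Qed.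

Lemma mem_permutation (p : permutation) x : (x \in (p : seq nat)) = (0 < x <= size p).
Proof. by case/andP: (one_lineP p) => _ /perm_mem ->; rewrite mem_iota add1n ltnS. Qed.

Lemma nth_perm_bounds (p : permutation) i : i < size p -> 0 < nth 0 p i <= size p.
Proof. by move=> ip; rewrite -mem_permutation mem_nth. Qed.

Lemma perm_size_gt0 (p : permutation) : 0 < size p.
Proof. by case/andP: (one_lineP p). Qed.

Lemma is_permutation_uniq (s : seq nat) :
  0 < size s -> uniq s -> {in s, forall x, 0 < x <= size s} -> is_permutation s.
Proof.
move=> s0 us sle; rewrite /is_permutation s0 /=.
have sub : {subset s <= iota 1 (size s)} by move=> x /sle; rewrite mem_iota add1n ltnS.
have [|_ mem_s] := uniq_min_size us sub; first by rewrite size_iota.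
by apply: uniq_perm => //; apply: iota_uniq.
Qed.

(** Without an inversion across the cut, the first [m] values lie below all others, so they are
    [1, ..., m] and [p] is a direct sum. *)
Lemma indecomposable_inversion (p : permutation) m :
  indecomposable p -> 0 < m < size p ->
  exists i j, [/\ i < m, m <= j, j < size p & nth 0 p j < nth 0 p i].
Proof.
move=> ind /andP[m0 mn].
have [/existsP[[i im] /existsP[[j jn] /= /andP[mj ji]]]|] :=
    boolP [exists i : 'I_m, exists j : 'I_(size p), (m <= j) && (nth 0 p j < nth 0 p i)].
  by exists i, j.
rewrite negb_exists => /forallP noinv; case: ind.
have szm : size (take m p) = m by rewrite size_takel // ltnW.
have up := permutation_uniq p.
have lt_cut x y : x \in take m p -> y \in drop m p -> x < y.
  move=> /(nthP 0)[i]; rewrite szm => im; rewrite nth_take // => <-.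
  move=> /(nthP 0)[j]; rewrite size_drop => jn; rewrite nth_drop => <-.
  have := noinv (Ordinal im); rewrite negb_exists => /forallP.
  have mj : m + j < size p by rewrite -ltn_subRL.
  move=> /(_ (Ordinal mj)) /=; rewrite leq_addr /= -leqNgt leq_eqVlt => /orP[|//].
  by rewrite nth_uniq //; lia.
have in_p x : x \in take m p -> 0 < x <= size p by move=> /mem_take; rewrite mem_permutation.
have tk : is_permutation (take m p).
  apply: is_permutation_uniq; rewrite ?szm ?take_uniq // => x xt.
  have /andP[x0 xn] := in_p x xt; rewrite x0 /= -szm -(size_iota 1 x).
  apply: uniq_leq_size; first exact: iota_uniq.
  move=> y; rewrite mem_iota add1n ltnS => /andP[y0 yx].
  have : y \in (p : seq nat) by rewrite mem_permutation y0 (leq_trans yx).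
  by rewrite -{1}(cat_take_drop m p) mem_cat => /orP[//|/(lt_cut _ _ xt)]; lia.
have dk : perm_eq (drop m p) (iota m.+1 (size p - m)).
  case/andP: (one_lineP p) => _; rewrite -{1}(cat_take_drop m p).
  have -> : iota 1 (size p) = iota 1 m ++ iota m.+1 (size p - m).
    by rewrite -[m.+1]add1n -iotaD subnKC // ltnW.
  move=> pp; rewrite -(perm_cat2l (iota 1 m)); apply: perm_trans pp.
  by rewrite perm_cat2r perm_sym; case/andP: tk => _; rewrite szm.
have dr : is_permutation [seq x - m | x <- drop m p].
  rewrite /is_permutation size_map size_drop subn_gt0 mn /=.
  apply: (perm_trans (perm_map (fun x => x - m) dk)).
  by rewrite -[m.+1]addn1 iotaDl -map_comp (@eq_map _ _ _ id) ?map_id // => x /=; lia.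
exists (Permutation tk), (Permutation dr); apply: val_inj => /=.
rewrite szm -map_comp map_id_in ?cat_take_drop // => x /=.
by rewrite (perm_mem dk) mem_iota; lia.
Qed.

(* The inversion graph of an indecomposable permutation is connected. *)
Lemma indecomposable_const (p : permutation) (key : nat -> nat) :
  indecomposable p ->
  (forall i j, i < j < size p -> nth 0 p j < nth 0 p i -> key i = key j) ->
  forall i, i < size p -> key i = key 0.
Proof.
move=> ind keyP m; have [k] := ubnP m; elim: k m => // k IH m mk mn.
have [->//|m0] := posnP m.
have [|i [j [im mj jn ji]]] := indecomposable_inversion (m := m) ind; first by rewrite m0.
have ki : key i = key 0 by apply: IH; lia.
have kj : key j = key i by rewrite -(keyP i j) //; lia.
have [jm|jm] := eqVneq m j; first by rewrite jm kj.
(* Position [m] lies between the inverted positions [i] and [j], hence forms an inversion with one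
   of them. *)
have [mi|mi] := ltnP (nth 0 p m) (nth 0 p i); first by rewrite -(keyP i) ?im.
by rewrite (keyP m j) ?kj //; lia.
Qed.

(** * Permutation patterns in interval families *)

Section Patterns.

Variables (T : finType) (L R : T -> nat).
Hypothesis epLR : endpoints L R.

Definition occurrence (s : seq nat) (f : nat -> T) : Prop :=
  forall i j, i < size s -> j < size s ->
    [/\ i < j -> R (f i) < R (f j),
        nth 0 s i < nth 0 s j -> L (f j) < L (f i)
      & L (f i) < R (f j)].

(** Only overlapping occurrences are forbidden: these are the ones that a [1] below and to the left
    completes. *)
Definition pattern_splittable (ps : seq permutation) (A : {set T}) : Prop :=
  exists2 c : T -> nat, {in A, forall x, c x < size ps} &
    forall j f, j < size ps -> occurrence (nth perm_one ps j) f ->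
      ~ forall i, i < size (nth perm_one ps j) -> f i \in A /\ c (f i) = j.

(** Inversions of overlapping intervals are crossings, so by [indecomposable_const] an occurrence
    stays in one key class, and the classes can be colored independently. *)
Lemma pattern_splittable_ideal ps :
  (forall q, q \in ps -> indecomposable q) ->
  (forall A : {set T}, {in A &, forall x y, L x < R y} -> pattern_splittable ps A) ->
  crossing_ideal L R (pattern_splittable ps).
Proof.
move=> ind clique; split=> // [A B /subsetP AB [c cB cP]|A key keyP keyS].
  exists c => [x /AB /cB //|j f jn occ H]; apply: (cP j f jn occ) => i /H[/AB]; split=> //.
have /fin_all_exists[c cP] (x : T) : exists c : T -> nat,
    {in [set y in A | key y == key x], forall y, c y < size ps} /\
    forall j f, j < size ps -> occurrence (nth perm_one ps j) f ->
      ~ forall i, i < size (nth perm_one ps j) ->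
          f i \in [set y in A | key y == key x] /\ c (f i) = j.
  by have [c c1 c2] := keyS (key x); exists c.
pose rep x := odflt x [pick y | key y == key x].
have repP x : key (rep x) = key x.
  by rewrite /rep; case: pickP => [y /eqP|] .
have rep_eq x y : key x = key y -> rep x = rep y.
  by rewrite /rep => <-; case: pickP => // /(_ x); rewrite eqxx.
exists (fun x => c (rep x) x) => [x xA|j f jn occ H].
  by have [+ _] := cP (rep x); apply; rewrite inE xA repP eqxx.
set q := nth _ ps j in occ H.
have key_const i : i < size q -> key (f i) = key (f 0).
  apply: (indecomposable_const (key := key \o f)) => [|{}i i' /andP[ii' i'q] inv /=].
    by apply: ind; apply: mem_nth.
  have iq := ltn_trans ii' i'q; have [fA _] := H i iq; have [f'A _] := H i' i'q.
  apply: keyP => //; have [r _ _] := occ _ _ iq i'q; have [_ l lr] := occ _ _ i'q iq.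
  by apply/orP; left; rewrite l // lr r.
have [_ /(_ j f jn occ)] := cP (rep (f 0)); apply=> i iq; have [fA fc] := H i iq.
have k := key_const i iq; rewrite inE fA repP k eqxx; split=> //.
by rewrite -(rep_eq _ _ k).
Qed.

(** Left ends reverse values: [x d] plays the value [size p - d], and [u d] is the position of that
    value. *)
Lemma occurrence_of_rich (p : permutation) A :
  rich L R (size p).-1 A -> exists f, occurrence p f.
Proof.
have p0 := perm_size_gt0 p; have up := permutation_uniq p.
have in_p x : 0 < x <= size p -> x \in (p : seq nat) by rewrite mem_permutation.
move=> /(rich_pattern (u := fun d => index (size p - d) p)) H.
have [|d d'|x [_ [_ x_incr x_u x_cl _]]] := H; first by case: epLR.
  rewrite !inE => dk d'k /(congr1 (nth 0 p)); rewrite !nth_index ?in_p //; lia.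
exists (fun i => x (size p - nth 0 p i)) => i j ip jp.
have vi := nth_perm_bounds ip; have vj := nth_perm_bounds jp; split=> [ij|ij|].
- have [/andP[_ wi] /andP[_ wj]] := (vi, vj).
  by apply: x_u; rewrite ?subKn ?index_uniq //; lia.
- by apply: x_incr; lia.
- by apply: x_cl; lia.
Qed.

(** Here [x d] plays the position [(size p).-1 - d], and [u d] is the value there. *)
Lemma occurrence_of_rich_reflect M (p : permutation) A :
  (forall x, R x <= M) ->
  rich (reflect_l M R) (reflect_l M L) (size p).-1 A -> exists f, occurrence p f.
Proof.
move=> R_le; have p0 := perm_size_gt0 p; have up := permutation_uniq p.
move=> /(rich_pattern (u := fun d => nth 0 p ((size p).-1 - d))) H.
have ltLR x : L x < R x by case: epLR.
have [x|d d'|x [_ [_ x_incr x_u x_cl _]]] := H.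
- by have := ltLR x; have := R_le x; rewrite /reflect_l; lia.
- rewrite !inE => dk d'k /eqP.
  by rewrite nth_uniq ?(leq_ltn_trans (leq_subr _ _)) ?ltn_predL // => /eqP; lia.
have RM d := R_le (x d); have LM d := ltLR (x d).
exists (fun i => x ((size p).-1 - i)) => i j ip jp; split=> [ij|ij|].
- have := x_incr ((size p).-1 - j) ((size p).-1 - i); rewrite /reflect_l.
  have := RM ((size p).-1 - j); have := RM ((size p).-1 - i); lia.
- by have := x_u ((size p).-1 - i) ((size p).-1 - j); rewrite /reflect_l !subKn; lia.
- have := x_cl ((size p).-1 - j) ((size p).-1 - i); rewrite /reflect_l.
  have := RM ((size p).-1 - j); have := RM ((size p).-1 - i).
  have := LM ((size p).-1 - j); have := LM ((size p).-1 - i); lia.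
Qed.

Lemma colorable_of_no_occurrence (p : permutation) (ps : seq permutation) :
  (forall q, q \in ps -> indecomposable q) ->
  (forall f, ~ occurrence p f) ->
  (forall A : {set T}, {in A &, forall x y, L x < R y} -> pattern_splittable ps A) ->
  colorable (pattern_splittable ps) (16 ^ size p) setT.
Proof.
move=> ind nocc clique; have goodP := pattern_splittable_ideal ind clique.
pose M := \max_x R x.
have R_le x : R x <= M by apply: leq_bigmax.
apply: (colorable_sub goodP (subsetT _) _
  (colorable_not_rich epLR R_le (p := (size p).-1) (q := (size p).-1) goodP _ _)).
- have -> : 16 ^ size p = 16 * 4 ^ ((size p).-1 + (size p).-1).
    by rewrite -{1}(prednK (perm_size_gt0 p)) expnS addnn -mul2n expnM.
  exact: leq_subr.
- by move=> /occurrence_of_rich[f /nocc].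
- by move=> /(occurrence_of_rich_reflect R_le)[f /nocc].
Qed.

End Patterns.

(** * Embeddings, subsequences and standardization *)

Lemma fin_choice_nat (T : Type) n (P : nat -> T -> Prop) :
  0 < n -> (forall i, i < n -> exists x, P i x) ->
  exists f : nat -> T, forall i, i < n -> P i (f i).
Proof.
move=> n0 exP; have /fin_all_exists[f fP] (i : 'I_n) : exists x, P i x by apply: exP.
exists (fun i => f (insubd (Ordinal n0) i)) => i ltin.
by have := fP (insubd (Ordinal n0) i); rewrite insubdK.
Qed.

Definition embeds (s t : seq nat) (f : nat -> nat) : Prop :=
  forall i j, i < size s -> j < size s ->
    [/\ f i < size t, i < j -> f i < f j
      & (nth 0 s i < nth 0 s j) = (nth 0 t (f i) < nth 0 t (f j))].

Lemma order_iso_sym s t : order_iso s t -> order_iso t s.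
Proof. by move=> [st lt]; split=> // i j it jt; rewrite lt ?st. Qed.

Lemma embeds_subseq s t f : embeds s t f ->
  let u := [seq nth 0 t (f i) | i <- iota 0 (size s)] in
  subseq u t /\ order_iso u s.
Proof.
move=> emb; split; last first.
  split=> [|i j]; rewrite !size_map size_iota // => si sj.
  have [_ _ ->] := emb i j si sj.
  by rewrite !(nth_map 0) ?size_iota // !nth_iota.
pose k := [seq f i | i <- iota 0 (size s)].
have -> : [seq nth 0 t (f i) | i <- iota 0 (size s)] = map (nth 0 t) k by rewrite -map_comp.
rewrite -{2}(mkseq_nth 0 t) /mkseq; apply: map_subseq.
have -> : k = [seq x <- iota 0 (size t) | x \in k]; last exact: filter_subseq.
apply: (irr_sorted_eq ltn_trans ltnn).
- apply/(sortedP 0) => i; rewrite size_map size_iota => si.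
  have si' := ltnW si; rewrite !(nth_map 0) ?size_iota // !nth_iota //.
  by have [_ + _] := emb i i.+1 si' si; apply.
- by apply: (sorted_filter ltn_trans); apply: iota_ltn_sorted.
move=> x; rewrite mem_filter andb_idr // => /mapP[i]; rewrite mem_iota add0n => si ->.
by rewrite mem_iota; have [] := emb i i si si.
Qed.

Lemma subseq_positions (u t : seq nat) : subseq u t ->
  exists f, forall i j, i < size u -> j < size u ->
    [/\ f i < size t, i < j -> f i < f j & nth 0 t (f i) = nth 0 u i].
Proof.
move=> /subseqP[m szm ->]; pose k := mask m (iota 0 (size t)).
have uE : mask m t = map (nth 0 t) k by rewrite map_mask -/(mkseq _ _) mkseq_nth.
rewrite uE; exists (nth 0 k) => i j; rewrite size_map => ik jk; split.
- have /mem_mask : nth 0 k i \in k by apply: mem_nth.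
  by rewrite mem_iota.
- move=> ij; apply: (sorted_ltn_nth ltn_trans) => //.
  by apply: (subseq_sorted ltn_trans (mask_subseq m _)); apply: iota_ltn_sorted.
- by rewrite (nth_map 0).
Qed.

Lemma containsP (p q : permutation) : contains p q <-> exists f, embeds q p f.
Proof.
split=> [[u /subseq_positions[f fP] [szu uq]]|[f /embeds_subseq[sub iso]]]; last first.
  by eexists; first exact: sub.
exists f => i j iq jq; rewrite -szu in iq jq.
have [f1 f2 f3] := fP i j iq jq; have [_ _ f4] := fP j j jq jq.
by rewrite f3 f4 uq.
Qed.

Lemma embeds_order_iso s t t' f : order_iso t t' -> embeds s t f -> embeds s t' f.
Proof.
move=> [szt tt'] emb i j si sj; have [fi fij eij] := emb i j si sj.
by have [fj _ _] := emb j j sj sj; rewrite -szt -tt' //.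
Qed.

Lemma standardization (s : seq nat) :
  uniq s -> s != [::] -> exists q : permutation, order_iso s q.
Proof.
move=> us; rewrite -size_eq0 -lt0n => s0.
pose rk x := (count (fun y => y < x) s).+1.
have rk_lt x y : x \in s -> x < y -> rk x < rk y.
  move=> xs xy; rewrite /rk ltnS.
  have : count (fun z => z < x) s + count_mem x s <= count (fun z => z < y) s.
    elim: (s) => //= z r IH; rewrite addnACA leq_add //.
    by case: (ltngtP z x) => // [zx|->]; [rewrite (ltn_trans zx xy) | rewrite xy].
  by have := xs; rewrite -has_pred1 has_count; lia.
have rk_mono : {in s &, forall x y, (x < y) = (rk x < rk y)}.
  move=> x y xs ys; apply/idP/idP => [/(rk_lt _ _ xs)//|].
  by case: (ltngtP x y) => // [/(rk_lt _ _ ys)|->]; lia.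
have q_perm : is_permutation (map rk s).
  apply: is_permutation_uniq; rewrite ?size_map //.
    rewrite map_inj_in_uniq // => x y xs ys e; apply/eqP.
    case: ltngtP => //; first by rewrite rk_mono // e ltnn.
    by rewrite rk_mono // e ltnn.
  move=> _ /mapP[x xs ->]; rewrite /rk /= -(count_predC (fun y => y < x)) -addn1 leq_add2l.
  by rewrite -has_count; apply/hasP; exists x => //=; rewrite ltnn.
exists (Permutation q_perm); split=> [|i j ilt jlt]; first by rewrite size_map.
by rewrite /= !(nth_map 0) // rk_mono // mem_nth.
Qed.

Lemma nth_flatten_nseq (T : Type) (x0 : T) (l : seq T) K i :
  0 < K -> nth x0 (flatten [seq nseq K x | x <- l]) i = nth x0 l (i %/ K).
Proof.
move=> K0; elim: l i => [|x l IH] i /=; first by rewrite !nth_nil.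
rewrite nth_cat size_nseq; have [iK|Ki] := ltnP i K.
  by rewrite nth_nseq iK divn_small.
by rewrite IH -{2}(subnK Ki) divnDr // divnn K0 addn1.
Qed.

Lemma size_flatten_nseq (T : Type) (l : seq T) K :
  size (flatten [seq nseq K x | x <- l]) = size l * K.
Proof. by elim: l => //= x l IH; rewrite size_cat size_nseq IH mulSn. Qed.

Lemma foldr_minn_mem m (s : seq nat) x : x \in s -> foldr minn m s <= x.
Proof.
elim: s => //= y s IH; rewrite inE => /predU1P[->|/IH]; first exact: geq_minl.
by apply: leq_trans; apply: geq_minr.
Qed.

Lemma leq_foldr_minn m (s : seq nat) k :
  (k <= foldr minn m s) = (k <= m) && all (leq k) s.
Proof. by elim: s => /= [|y s IH]; rewrite ?andbT // leq_min IH andbCA. Qed.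

(** * Entries of a permutation as intervals on the staircase *)

(* The left-to-right minima of [r] form a staircase. The horizontal and the    *)
(* vertical projections of any other entry to it are the endpoints of the      *)
(* interval of the minima below and to the left of that entry; position minus  *)
(* value, shifted by [size r], parametrizes the staircase.                     *)
Section Staircase.

Variable r : permutation.

Definition above_minimum (i : 'I_(size r)) : bool :=
  has (fun y => y < nth 0 r i) (take i r).

Definition entry : predArgType := {i : 'I_(size r) | above_minimum i}.

Definition pos (x : entry) : nat := val (val x).

Definition value (x : entry) : nat := nth 0 r (pos x).

Definition left_end (x : entry) : nat :=
  find (fun y => y < value x) r + (size r - value x).

Definition right_end (x : entry) : nat :=
  pos x + (size r - foldr minn (size r) (take (pos x) r)).

Lemma pos_lt x : pos x < size r. Proof. exact: ltn_ord. Qed.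

Lemma entry_exists k m :
  m < k < size r -> nth 0 r m < nth 0 r k -> exists x : entry, pos x = k.
Proof.
move=> /andP[mk kr] lt.
have am : above_minimum (Ordinal kr).
  apply/(has_nthP 0); exists m => /=; first by rewrite size_takel // ltnW.
  by rewrite nth_take.
by exists (Sub (Ordinal kr) am).
Qed.

Lemma pos_inj : injective pos.
Proof. by move=> x y /val_inj/val_inj. Qed.

Lemma value_inj : injective value.
Proof.
move=> x y /eqP; rewrite nth_uniq ?pos_lt ?permutation_uniq // => /eqP; exact: pos_inj.
Qed.

Lemma value_le x : value x <= size r.
Proof.
by have /andP[] := nth_perm_bounds (pos_lt x).
Qed.

Lemma above_minimumP x : exists2 m, m < pos x & nth 0 r m < value x.
Proof.
have /(has_nthP 0)[m] := valP x; rewrite size_takel; last exact/ltnW/pos_lt.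
by move=> mx; rewrite nth_take //; exists m.
Qed.

Lemma left_end_value x y : (left_end x < left_end y) = (value y < value x).
Proof.
have H u v : value v < value u -> left_end u < left_end v.
  move=> vu; rewrite /left_end -addnS leq_add //.
    by apply: sub_find => z /= zv; apply: ltn_trans vu.
  by have := value_le u; lia.
apply/idP/idP => [|/H //]; case: (ltngtP (value y) (value x)) => // [/H|/value_inj ->]; lia.
Qed.

Lemma right_end_pos x y : (right_end x < right_end y) = (pos x < pos y).
Proof.
have H u v : pos u < pos v -> right_end u < right_end v.
  move=> uv; rewrite /right_end -addSn leq_add // leq_sub2l // leq_foldr_minn.
  have := leqnn (foldr minn (size r) (take (pos v) r)).
  rewrite leq_foldr_minn => /andP[-> /=] /allP all_v; apply/allP => z zu; apply: all_v.
  by move: zu; rewrite -(take_takel r (ltnW uv)) => /mem_take.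
apply/idP/idP => [|/H //]; case: (ltngtP (pos x) (pos y)) => // [/H|/pos_inj ->]; lia.
Qed.

Lemma left_right_end x y :
  (left_end x < right_end y) = has (fun z => z < value x) (take (pos y) r).
Proof.
rewrite /left_end /right_end; set a := fun z => _.
have hE : has a (take (pos y) r) = (find a r < pos y) by rewrite has_take_leq // ltnW ?pos_lt.
have vx := value_le x; apply/idP/idP => [|h].
  apply: contraLR => nh; rewrite -leqNgt leq_add //; first by move: nh; rewrite hE -leqNgt.
  rewrite leq_sub2l // leq_foldr_minn vx; apply/allP => z zr.
  by rewrite leqNgt; apply: contraNN nh => zx; apply/hasP; exists z.
have /hasP[z zr zx] := h; move: h; rewrite hE => fy.
rewrite -addSn leq_add // leq_sub2l //.
exact: leq_trans (foldr_minn_mem _ zr) (ltnW zx).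
Qed.

Lemma staircase_endpoints : endpoints left_end right_end.
Proof.
split=> [x y e|x y e|x|x y].
- apply: value_inj; have := left_end_value x y; have := left_end_value y x.
  by rewrite e; lia.
- apply: pos_inj; have := right_end_pos x y; have := right_end_pos y x.
  by rewrite e; lia.
- by rewrite left_right_end; apply: (valP x).
(* Equality would put the first value below [value x] at [pos y], so [y] would be a left-to-right
   minimum. *)
apply/eqP => e; have := left_right_end x y; rewrite e ltnn => /esym/negbT nh.
have [m my mv] := above_minimumP y.
have sy : size (take (pos y) r) = pos y by rewrite size_takel // ltnW ?pos_lt.
have lev m' : m' < pos y -> value x <= nth 0 r m'.
  move=> m'y; rewrite leqNgt; apply: contraNN nh => lt.
  by apply/(has_nthP 0); exists m'; rewrite ?sy ?nth_take.
have fy : pos y <= find (fun z => z < value x) r.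
  rewrite leqNgt; apply/negP => fy; have := lev _ fy; rewrite leqNgt => /negP; apply.
  by apply: (@nth_find _ 0 (fun z => z < value x)); rewrite has_find (ltn_trans fy) ?pos_lt.
have le_min : size r - foldr minn (size r) (take (pos y) r) <= size r - value x.
  rewrite leq_sub2l // leq_foldr_minn value_le; apply/(all_nthP 0) => m'.
  by rewrite sy => m'y; rewrite nth_take // lev.
have def_y : find (fun z => z < value x) r = pos y.
  by apply/eqP; rewrite eqn_leq fy andbT; move: e; rewrite /left_end /right_end; lia.
have : value y < value x.
  rewrite {1}/value -def_y; apply: (@nth_find _ 0 (fun z => z < value x)).
  by rewrite has_find def_y pos_lt.
by have := lev m my; lia.
Qed.

Lemma occurrence_contains (q : permutation) f :
  occurrence left_end right_end q f -> contains r (dsum perm_one q).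
Proof.
move=> occ; have q0 := perm_size_gt0 q.
have q1 : 1 \in (q : seq nat) by rewrite mem_permutation.
have i1q : index 1 q < size q by rewrite index_mem.
(* The lowest entry overlaps the first one, which yields [m] below and to the left of all entries,
   to play the added [1]. *)
have [_ _] := occ _ _ i1q q0; rewrite left_right_end.
have sf : size (take (pos (f 0)) r) = pos (f 0) by rewrite size_takel // ltnW ?pos_lt.
move=> /(has_nthP 0)[m]; rewrite sf => mf; rewrite nth_take // => mv.
have pos_incr i j : i < size q -> j < size q -> i < j -> pos (f i) < pos (f j).
  by move=> iq jq ij; have [+ _ _] := occ i j iq jq; rewrite right_end_pos; apply.
have value_incr i j : i < size q -> j < size q ->
    nth 0 q i < nth 0 q j -> value (f i) < value (f j).
  by move=> iq jq ij; have [_ + _] := occ i j iq jq; rewrite left_end_value; apply.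
have m_value i : i < size q -> nth 0 r m < value (f i).
  move=> iq; apply: (leq_trans mv); have [->//|ne] := eqVneq i (index 1 q).
  apply/ltnW/value_incr => //; rewrite nth_index // ltn_neqAle eq_sym.
  rewrite -{1}(nth_index 0 q1) nth_uniq ?permutation_uniq // ne /=.
  by have /andP[] := nth_perm_bounds iq.
have m_pos i : i < size q -> m < pos (f i).
  by case: i => // i iq; apply: (ltn_trans mf); apply: pos_incr.
apply/containsP; exists (fun i => if i is i'.+1 then pos (f i') else m).
have nthS i : i < size q -> nth 0 (dsum perm_one q) i.+1 = (nth 0 q i).+1.
  by move=> iq /=; rewrite (nth_map 0) // addn1.
move=> i j; rewrite /= size_map !ltnS.
have mr : m < size r by apply: ltn_trans mf (pos_lt _).
case: i j => [|i] [|j] iq jq; rewrite ?ltnn; split=> //; try exact: pos_lt.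
- by move=> _; apply: m_pos.
- rewrite nthS // m_value //= ltnS.
  by have /andP[-> _] := nth_perm_bounds jq.
- have := m_value i iq; rewrite nthS //= ltnS => lt.
  by rewrite ltn0 [RHS]ltnNge ltnW.
- by rewrite ltnS; apply: pos_incr.
rewrite !nthS // ltnS -!/(value _); apply/idP/idP; first exact: value_incr.
case: (ltngtP (nth 0 q i) (nth 0 q j)) => // [/(value_incr _ _ jq iq)|/eqP]; first by lia.
by rewrite nth_uniq ?permutation_uniq // => /eqP ->; rewrite ltnn.
Qed.

Lemma occurrence_of_embeds (q : permutation) g f :
  embeds q r g -> (forall i, i < size q -> pos (f i) = g i) ->
  (forall i j, i < size q -> j < size q -> left_end (f i) < right_end (f j)) ->
  occurrence left_end right_end q f.
Proof.
move=> emb fg cl i j iq jq; have [_ gij lt] := emb i j iq jq.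
split; last exact: cl; first by rewrite right_end_pos !fg.
by rewrite left_end_value /value !fg // lt.
Qed.

(** As members of [A] overlap, a copy of [p] among them would be an occurrence. So their
    standardization [w] avoids [p], and the coloring of [w] is pulled back along [wv]. *)
Lemma splittable_clique (p : permutation) (ps : seq permutation) (A : {set entry}) :
  (forall f, ~ occurrence left_end right_end p f) ->
  splitting [seq Av q | q <- ps] (Av p) ->
  {in A &, forall x y, left_end x < right_end y} ->
  pattern_splittable left_end right_end ps A.
Proof.
move=> nocc split_p Acl.
have [->|[x0 x0A]] := set_0Vmem A.
  exists (fun=> 0) => [x|j f jn occ H]; first by rewrite inE.
  by have [] := H 0 (perm_size_gt0 _); rewrite inE.
pose k := [seq i <- iota 0 (size r) | [exists x in A, pos x == i]].
have mem_k x : x \in A -> pos x \in k.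
  move=> xA; rewrite mem_filter mem_iota leq0n pos_lt !andbT.
  by apply/exists_inP; exists x.
have kr i : i \in k -> i < size r by rewrite mem_filter mem_iota => /andP[].
have k_sorted : sorted ltn k by apply: (sorted_filter ltn_trans); apply: iota_ltn_sorted.
have uk : uniq k by rewrite filter_uniq ?iota_uniq.
have [||w iso_w] := @standardization (map (nth 0 r) k).
- rewrite map_inj_in_uniq // => i j /kr ir /kr jr /eqP.
  by rewrite nth_uniq ?permutation_uniq // => /eqP.
- by have := mem_k _ x0A; case: (k).
have [sz_w lt_w] := iso_w; rewrite size_map in sz_w lt_w.
have w_avoids : Av p w.
  move=> /containsP[g /(embeds_order_iso (order_iso_sym iso_w)) emb].
  have gk i : i < size p -> g i < size k.
    by move=> ip; have [+ _ _] := emb i i ip ip; rewrite size_map.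
  have [||f fP] := @fin_choice_nat entry (size p) (fun i x => x \in A /\ pos x = nth 0 k (g i)).
  + exact: perm_size_gt0.
  + move=> i /gk/(mem_nth 0); rewrite mem_filter => /andP[/exists_inP[x xA /eqP xg] _].
    by exists x.
  apply: (nocc f); apply: (@occurrence_of_embeds _ (fun i => nth 0 k (g i))).
  + move=> i j ip jp; have [_ gij lt] := emb i j ip jp; split.
    * exact/kr/mem_nth/gk.
    * by move=> /gij gg; apply: (sorted_ltn_nth ltn_trans) => //; apply: gk.
    * by rewrite lt !(nth_map 0) // gk.
  + by move=> i /fP[].
  + by move=> i j /fP[iA _] /fP[jA _]; apply: Acl.
have [c cP] := split_p w w_avoids.
pose wv x := nth 0 w (index (pos x) k).
exists (fun x => val (c (wv x))) => [x _|j f jn occ H].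
  by rewrite -(size_map Av ps); apply: ltn_ord.
set q := nth _ ps j in occ H.
have jn' : j < size [seq Av q | q <- ps] by rewrite size_map.
have q0 := perm_size_gt0 q.
have ik i : i < size q -> index (pos (f i)) k < size k.
  by move=> /H[fA _]; rewrite index_mem mem_k.
have nk i : i < size q -> nth 0 k (index (pos (f i)) k) = pos (f i).
  by move=> /H[fA _]; rewrite nth_index ?mem_k.
have emb : embeds q w (fun i => index (pos (f i)) k).
  move=> i i' iq i'q; have [] := occ i i' iq i'q; rewrite right_end_pos left_end_value.
  have [_ + _] := occ i' i i'q iq; rewrite left_end_value => v' rr v _; split.
  - by rewrite -sz_w ik.
  - move=> /rr; rewrite -{1}nk // -{1}(nk i') //; apply: contraTT.
    rewrite -!leqNgt leq_eqVlt => /predU1P[->//|lt]; apply: ltnW.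
    by apply: (sorted_ltn_nth ltn_trans) => //; apply: ik.
  rewrite -lt_w ?ik // !(nth_map 0) ?ik // !nk //.
  apply/idP/idP => [//|]; case: (ltngtP (nth 0 q i) (nth 0 q i')) => // [/v'|/eqP].
    by rewrite /value; lia.
  by rewrite nth_uniq ?permutation_uniq // => /eqP ->; rewrite ltnn.
have [sub_u iso_u] := embeds_subseq emb.
set u := map _ _ in sub_u iso_u.
have /= := cP (Ordinal jn').
have : subseq u [seq x <- (w : seq nat) | c x == Ordinal jn'].
  rewrite subseq_filter sub_u andbT; apply/allP => x /mapP[i]; rewrite mem_iota => iq ->.
  by have [_ cj] := H i iq; apply/eqP/val_inj.
set w' := filter _ _ => sub_u' [w0|[t tq iso_t]].
  by move: sub_u'; rewrite w0 subseq0 -size_eq0 size_map size_iota; case: (size q) q0.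
have [g gP] := subseq_positions sub_u'.
move: tq; rewrite (tnth_nth (Av perm_one)) /= (nth_map perm_one) //; apply.
apply/containsP; exists g; apply: (embeds_order_iso iso_t) => i i' iq i'q.
have [su lt_u] := iso_u; rewrite -su in iq i'q.
have [g1 g2 g3] := gP i i' iq i'q; have [_ _ g4] := gP i' i' i'q i'q.
by rewrite g3 g4 lt_u.
Qed.

End Staircase.

(** * Combining the two colorings *)

Theorem theorem3p15 (n : nat) (p : permutation) (ps : seq permutation) :
  perm_order p = n ->
  indecomposable p ->
  ps <> [::] ->
  (forall q : permutation, q \in ps -> indecomposable q) ->
  splitting [seq Av q | q <- ps] (Av p) ->
  exists K : nat, K <= 16 ^ n /\
    splitting (mset_scale [seq Av (dsum perm_one q) | q <- ps] K) (Av (dsum perm_one p)).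
Proof.
move=> <- _ ps0 ind split_p; exists (16 ^ size p); split=> // r av_r.
have av_r' : avoids r (dsum perm_one p) := av_r.
have : colorable (pattern_splittable (@left_end r) (@right_end r) ps) (16 ^ size p) setT.
  apply: (colorable_of_no_occurrence (staircase_endpoints r) (p := p)) => // [f|A].
    by move=> /occurrence_contains/av_r'.
  by apply: splittable_clique split_p => f /occurrence_contains/av_r'.
have : 0 < 16 ^ size p by rewrite expn_gt0.
move: (16 ^ size p) => K K0 [c cK cP].
have /fin_all_exists2[d d_lt dP] (i : 'I_K) := cP i.
set S := mset_scale _ _.
have szS : size S = size ps * K by rewrite /S /mset_scale size_flatten_nseq size_map.
have S0 : 0 < size S by rewrite szS muln_gt0 K0 lt0n size_eq0; case: (ps) ps0.
(* The pair of colors is coded with the pattern as quotient by [K], since [mset_scale] lists the [K]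
   copies of a class consecutively. *)
pose num x := d (insubd (Ordinal K0) (c x)) x * K + c x.
(* Left-to-right minima get the default color 0; this is harmless, as in a copy of [dsum perm_one q]
   they can only play the [1]. *)
pose col v := odflt 0 (omap num [pick x | value x == v]).
exists (fun v => insubd (Ordinal S0) (col v)) => a.
set w := filter _ _; have [-> |w_ne] := eqVneq w [::]; [by left | right].
have uw : uniq w by rewrite filter_uniq ?permutation_uniq.
have [t iso_t] := standardization uw w_ne; exists t => //.
have aS : a %/ K < size ps by rewrite ltn_divLR // -szS.
rewrite (tnth_nth (Av perm_one)) /= /S /mset_scale nth_flatten_nseq // (nth_map perm_one) //.
move=> /containsP[g /(embeds_order_iso (order_iso_sym iso_t)) /embeds_subseq[]].
set q := nth _ ps _; set u := map _ _ => sub_u [sz_u lt_u].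
have [h hP] := subseq_positions (subseq_trans sub_u (filter_subseq _ _)).
have szu : size u = (size q).+1 by rewrite sz_u /= size_map.
have u_lt i : i < size q -> nth 0 u 0 < nth 0 u i.+1.
  move=> iq; rewrite lt_u ?szu //= (nth_map 0) // addn1 ltnS.
  by have /andP[] := nth_perm_bounds iq.
(* All further entries of a monochromatic copy lie above and to the right of its first one, so they
   are intervals over a common minimum. *)
have [||f fP] := @fin_choice_nat (entry r) (size q) (fun i x => pos x = h i.+1).
- exact: perm_size_gt0.
- move=> i iq; have [||_ h_lt h0] := hP 0 i.+1; rewrite ?szu //.
  have [||hi _ hE] := hP i.+1 0; rewrite ?szu //.
  by apply: (@entry_exists r _ (h 0)); rewrite ?h_lt // h0 hE u_lt.
have num_a i : i < size q -> num (f i) = a.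
  move=> iq; have [||hi _ hE] := hP i.+1 0; rewrite ?szu //.
  have : nth 0 u i.+1 \in w by apply: (mem_subseq sub_u); rewrite mem_nth ?szu.
  rewrite mem_filter => /andP[/eqP/(congr1 val) + _].
  rewrite -hE -fP // /col; case: pickP => [x /eqP/value_inj ->|/(_ (f i))]; last by rewrite eqxx.
  rewrite val_insubd ifT //= szS /num.
  set k := insubd _ _; have kE : val k = c (f i) by rewrite val_insubd cK.
  have := d_lt k (f i); rewrite !inE -kE eqxx => /(_ isT) lt_d.
  apply: (@leq_trans ((d k (f i)).+1 * K)); last by rewrite leq_mul2r lt_d orbT.
  by rewrite mulSn [K + _]addnC ltn_add2l; apply: ltn_ord.
have c_a i : i < size q -> c (f i) = a %% K.
  move=> iq; rewrite -(num_a i iq) /num modnMDl modn_small //; exact: cK.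
have aK : a %% K < K by rewrite ltn_mod.
have := dP (Ordinal aK) (a %/ K) f aS; apply.
- apply: (@occurrence_of_embeds _ _ (fun i => h i.+1)) => // [i j iq jq|i j iq jq].
    have [||hi h_lt hE] := hP i.+1 j.+1; rewrite ?szu //.
    have [||hj _ hE'] := hP j.+1 j.+1; rewrite ?szu //.
    split=> //; rewrite hE hE' lt_u ?szu //=.
    by rewrite !(nth_map 0) // !addn1 ltnS.
  rewrite left_right_end; have [||h0 h_lt hE] := hP 0 j.+1; rewrite ?szu //.
  have [||hi _ hE'] := hP i.+1 j.+1; rewrite ?szu //.
  apply/(has_nthP 0); exists (h 0).
    by rewrite size_takel ?(ltnW (pos_lt _)) // fP ?h_lt.
  by rewrite nth_take ?fP ?h_lt // /value fP // hE hE' u_lt.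
- move=> i iq; rewrite !inE c_a //= eqxx; split=> //.
  rewrite -{2}(num_a i iq) /num.
  have -> : insubd (Ordinal K0) (c (f i)) = Ordinal aK.
    by apply: val_inj; rewrite val_insubd c_a // aK.
  by rewrite divnMDl // divn_small ?addn0 ?cK.
Qed.
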